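(* Let $W$ be the following set of words over the alphabet $\{a,b\}$: $$W=\{ab^2ab^2a,\ ab^2a^2b^2a,\ abab^2aba,\ ab^3aba,\ abab^3a,\ ab^3ab^3a,\ ba^2baba^2b,\ a^2b^3a,\ ba^2ba^2b,\ ba^2b^2a^2b,\ baba^2bab,\ ba^3bab,\ baba^3b,\ ba^3ba^3b,\ ab^2abab^2a,\ b^2a^3b,\ a^2b^3a^2,\ b^2a^3b^2\}.$$ Every $3$-full word over $\{a,b\}$ that contains every word of $W$ as a factor is a $3$-collapsing word on the alphabet $\{a,b\}$.
   Context: A (semi)automaton is a triple $\mathcal A=(Q,\Sigma,\delta)$ with $Q$ a finite set of states, $\Sigma$ an alphabet and $\delta:Q\times\Sigma\to Q$ a total function. Words act on states from the right, letter by letter from left to right: $qw$ is the state reached from $q$ by reading $w$, and $Qw=\{qw: q\in Q\}$. The deficiency of $w\in\Sigma^+$ for $\mathcal A$ is $|Q|-|Qw|$. The word $w$ is $3$-compressing for $\mathcal A$ if its deficiency is at least $3$; $\mathcal A$ is $3$-compressible if some word is $3$-compressing for it. A word $w\in\Sigma^+$ is $3$-collapsing if it is $3$-compressing for every $3$-compressible automaton with input alphabet $\Sigma$. A factor of a word is a contiguous subword. A word over $\{a,b\}$ is $3$-full if it contains each of the eight words of length $3$ over $\{a,b\}$ as a factor. *)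

(* Defs.v *)
From HB Require Import structures.
From mathcomp Require Import all_boot.

Set Implicit Arguments.
Unset Strict Implicit.
Unset Printing Implicit Defensive.

Inductive letter := a | b.

Definition bool_of_letter (x : letter) : bool := if x is a then false else true.
Definition letter_of_bool (x : bool) : letter := if x then b else a.

Lemma bool_of_letterK : cancel bool_of_letter letter_of_bool.
Proof. by case. Qed.

HB.instance Definition _ := Finite.copy letter (can_type bool_of_letterK).

Record semiautomaton (Sigma : Type) := Semiautomaton {
  state : finType;
  trans : state -> Sigma -> state
}.

(* The right action of words: q x1 x2 ... xn = (...((q x1) x2)...) xn. *)
Definition act (Sigma : Type) (A : semiautomaton Sigma)
    (q : state A) (w : seq Sigma) : state A := foldl (@trans _ A) q w.

Definition image_word (Sigma : Type) (A : semiautomaton Sigma)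
    (w : seq Sigma) : {set state A} := [set act q w | q : state A].

(* The truncated subtraction is exact, as #|Q w| <= #|Q|. *)
Definition deficiency (Sigma : Type) (A : semiautomaton Sigma)
    (w : seq Sigma) : nat := #|state A| - #|image_word A w|.

Definition compressing (k : nat) (Sigma : Type) (A : semiautomaton Sigma)
    (w : seq Sigma) : Prop := 0 < size w /\ k <= deficiency A w.

Definition compressible (k : nat) (Sigma : Type) (A : semiautomaton Sigma) :
    Prop := exists w : seq Sigma, compressing k A w.

Definition collapsing (k : nat) (Sigma : Type) (w : seq Sigma) : Prop :=
  0 < size w /\
  forall A : semiautomaton Sigma, compressible k A -> compressing k A w.

(* [infix u w] says that u is a contiguous factor of w. *)
Definition full (k : nat) (Sigma : eqType) (w : seq Sigma) : Prop :=
  forall u : seq Sigma, size u = k -> infix u w.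

Definition W : seq (seq letter) := [::
  [:: a; b; b; a; b; b; a];
  [:: a; b; b; a; a; b; b; a];
  [:: a; b; a; b; b; a; b; a];
  [:: a; b; b; b; a; b; a];
  [:: a; b; a; b; b; b; a];
  [:: a; b; b; b; a; b; b; b; a];
  [:: b; a; a; b; a; b; a; a; b];
  [:: a; a; b; b; b; a];
  [:: b; a; a; b; a; a; b];
  [:: b; a; a; b; b; a; a; b];
  [:: b; a; b; a; a; b; a; b];
  [:: b; a; a; a; b; a; b];
  [:: b; a; b; a; a; a; b];
  [:: b; a; a; a; b; a; a; a; b];
  [:: a; b; b; a; b; a; b; b; a];
  [:: b; b; a; a; a; b];
  [:: a; a; b; b; b; a; a];
  [:: b; b; a; a; a; b; b]].

(* Main.v *)
Require Import Defs.
From mathcomp Require Import all_boot.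

Set Implicit Arguments.
Unset Strict Implicit.
Unset Printing Implicit Defensive.

(** Let [missing w] be the complement of the image of [w], so that the
    deficiency of [w] is the size of [missing w], and a word is at least as
    deficient as each of its factors.  Call [aaa], [bbb] and the words of [W]
    the probes.  All probes are factors of the given word, so it is enough to
    show, for one automaton at a time, that if all probes have deficiency at
    most 2 then so has every word ([probes_suffice]).

    Reading a letter [l] after [w] turns [missing w] into the set of states
    whose fibre under [l] lies in [missing w] ([missing_rcons]).  As long as
    [missing w] has at most two elements, this set is determined by very little
    of the automaton: the states missed by [l], the fibres of [l] that meet
    [missing w], and the values of [l] on the fibres contained in it.  Those
    fibres are small and mostly singletons, because the excesses of the sizes
    of nonempty fibres over 1 add up to the number of states missed by [l]
    ([sum_excess]).  This makes it possible to settle the claim by a finite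
    case analysis on an automaton of which only the relevant part is known,
    whatever its number of states.  One first names the states missed by [a] and
    by [b], and then reads the probes one after the other; whenever an unknown
    fibre or value is consulted, one splits into all ways of describing it by
    states that have a name already and by new states.  A branch is dropped as
    soon as a probe misses three states.  In every branch that survives all the
    probes, the sets missed by words turn out to form a family of sets that have
    at most two elements, all of them named by then.

    This analysis is a boolean function, evaluated in [search_succeeds].  Its
    continuation argument [cont] stands for the rest of the analysis and has
    to hold in all branches.  The second half of the proof shows that the
    description given by one of the branches is true of the actual automaton
    ([true_branch]), where the final certificate bounds the deficiency of all
    words ([stableP]). *)

(** * Partial descriptions of an automaton *)

(** What is known of the action of one letter, the states being named by
    numbers: the names of all the states that it misses, some complete fibres,
    and arrows from a name to the name of its image.  The number [spare] is
    what the other fibres still contribute to the identity [sum_excess]; it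
    bounds the size of every further fibre by [spare + 1]. *)
Record profile := Profile {
  lost : seq nat;
  fibres : seq (seq nat);
  spare : nat;
  arrows : seq (nat * nat)
}.

Record sketch := Sketch {
  known_names : nat;
  on_a : profile;
  on_b : profile
}.

Definition profile_of (s : sketch) (l : letter) : profile :=
  if l is a then on_a s else on_b s.

Definition update (s : sketch) (l : letter) (n : nat) (p : profile) : sketch :=
  if l is a then Sketch n p (on_b s) else Sketch n (on_a s) p.

(** The known fibre that contains [i]; it is empty, and thus does not contain
    [i], as long as that fibre is unknown. *)
Definition fibre_of (p : profile) (i : nat) : seq nat :=
  head [::] [seq c <- fibres p | i \in c].

(** An arrow from any element of the fibre gives the common value. *)
Definition value_of (p : profile) (i : nat) : option nat :=
  ohead [seq e.2 | e <- arrows p & e.1 \in fibre_of p i].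

(** If [m] names the states missed by a word, the covered names are those whose
    image is missed once the letter is read as well. *)
Definition covered (p : profile) (m : seq nat) (i : nat) : bool :=
  let c := fibre_of p i in (i \in c) && all [in m] c.

(** One name per fibre.  It lets the images be counted before any value of the
    letter is known. *)
Fixpoint independent (p : profile) (m : seq nat) : seq nat :=
  if m is i :: m' then
    let r := independent p m' in
    if has [in fibre_of p i] r then r else i :: r
  else [::].

Definition too_many (p : profile) (m : seq nat) : bool :=
  2 < size (lost p) + size (independent p [seq i <- m | covered p m i]).

(** The result lists names in increasing order, so that two names of the same
    set are equal lists. *)
Definition next_lost (s : sketch) (l : letter) (m : seq nat) :
    option (seq nat) :=
  let p := profile_of s l in
  let vs := [seq value_of p i | i <- m & covered p m i] in
  if all [pred i | i \in fibre_of p i] m && all isSome vs then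
    Some [seq j <- iota 0 (known_names s) | (j \in lost p) || (Some j \in vs)]
  else None.

(** All descriptions of a set of [k] states of which only those named in [cand]
    can have one of the names below [n]: the other states get the names [n],
    [n + 1], and so on.  The second component is the new number of names. *)
Fixpoint namings (n : nat) (cand : seq nat) (k : nat) : seq (seq nat * nat) :=
  if cand is i :: cand' then
    (if k is k'.+1 then [seq (i :: x.1, x.2) | x <- namings n cand' k']
     else [::]) ++ namings n cand' k
  else [:: (iota n k, n + k)].

(** * The case analysis *)

(** The names of the fibre of [i] other than [i] avoid the known fibres. *)
Definition reveal_fibre (l : letter) (i : nat) (s : sketch)
    (cont : sketch -> bool) : bool :=
  let p := profile_of s l in
  if i \in fibre_of p i then cont s else
  let cand := [seq j <- iota 0 (known_names s) |
                 (j != i) && ~~ has (fun c => j \in c) (fibres p)] in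
  all (fun k => all (fun x =>
         let c := i :: x.1 in
         cont (update s l x.2
           (Profile (lost p) (c :: fibres p) (spare p - k) (arrows p))))
       (namings (known_names s) cand k)) (iota 0 (spare p).+1).

(** The fibre of [i] has to be known here: only then is the target of an arrow
    from outside this fibre excluded as the image of [i]. *)
Definition reveal_value (l : letter) (i : nat) (s : sketch)
    (cont : sketch -> bool) : bool :=
  let p := profile_of s l in
  if isSome (value_of p i) then cont s else
  let taken := lost p ++ [seq e.2 | e <- arrows p] in
  let cand := [seq j <- iota 0 (known_names s) | j \notin taken] in
  (i \in fibre_of p i) && all (fun x =>
         let e := (i, head 0 x.1) in
         cont (update s l x.2
           (Profile (lost p) (fibres p) (spare p) (e :: arrows p))))
    (namings (known_names s) cand 1).

Fixpoint reveal (ask : nat -> sketch -> (sketch -> bool) -> bool) (m : seq nat)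
    (s : sketch) (cont : sketch -> bool) : bool :=
  if m is i :: m' then
    (i < known_names s) && ask i s (fun s' => reveal ask m' s' cont)
  else cont s.

Definition reveal_values l m s cont :=
  let p := profile_of s l in
  reveal (reveal_value l) [seq i <- m | covered p m i] s cont.

(** Here [m] names the states missed by what has been read before [w].  A branch
    is dropped, by answering [true], once three states are missed.  Values are
    not revealed for the last letter, as the number of missed states depends on
    the fibres only; without this the analysis would branch far more. *)
Fixpoint read_word (w : seq letter) (m : seq nat) (s : sketch)
    (cont : sketch -> bool) : bool :=
  if w is l :: w' then
    reveal (reveal_fibre l) m s (fun s1 =>
      (* A disjunction would also evaluate the rest of a dropped branch. *)
      if too_many (profile_of s1 l) m then true else
      if nilp w' then cont s1 else
      reveal_values l m s1 (fun s2 =>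
        if next_lost s2 l m is Some m' then read_word w' m' s2 cont else false))
  else cont s.

Fixpoint read_all (ws : seq (seq letter)) (s : sketch)
    (cont : sketch -> bool) : bool :=
  if ws is w :: ws' then read_word w [::] s (fun s' => read_all ws' s' cont)
  else cont s.

(** The certificate that ends a branch: a family of small sets that contains
    the empty set and is closed under reading a letter. *)
Definition stable (s : sketch) (F : seq (seq nat)) : bool :=
  ([::] \in F) &&
  all (fun m => (size m <= 2) &&
    all (fun l => if next_lost s l m is Some m' then m' \in F else false)
      [:: a; b]) F.

(** Breadth-first closure of the family [F].  Nothing is assumed about the
    lists that it builds, since the certificate is checked anew at the end. *)
Fixpoint explore (fuel : nat) (F todo : seq (seq nat)) (s : sketch) : bool :=
  match fuel, todo with
  | fuel'.+1, m :: todo' =>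
    let visit l s cont := reveal (reveal_fibre l) m s (fun s1 =>
           reveal_values l m s1 cont) in
    visit a s (fun s1 => visit b s1 (fun s2 =>
      let new := [seq m' <- undup (pmap (fun l => next_lost s2 l m) [:: a; b])
                 | m' \notin F] in
      explore fuel' (F ++ new) (todo' ++ new) s2))
  | _, _ => stable s F
  end.

(** If the probes have deficiency at most 2 then so do the letters.  The states
    that they miss are the first to be named, and at this point all of the excess of
    the letter is spare. *)
Definition start (cont : sketch -> bool) : bool :=
  all (fun ka => all (fun x =>
    all (fun kb => all (fun y =>
       cont (Sketch y.2 (Profile x.1 [::] ka [::]) (Profile y.1 [::] kb [::])))
      (namings x.2 (iota 0 x.2) kb)) (iota 0 3))
    (namings 0 [::] ka)) (iota 0 3).

Definition probes : seq (seq letter) := [:: [:: a; a; a], [:: b; b; b] & W].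

(** Twelve rounds of [explore] are enough to close every family met here. *)
Lemma search_succeeds :
  start (fun s => read_all probes s (explore 12 [:: [::]] [:: [::]])).
Proof. by vm_compute. Qed.

(** * The states missed by a word *)

Section Semantics.

Variables (A : semiautomaton letter) (q0 : state A).
Implicit Types (l : letter) (u v w : seq letter) (qs zs : seq (state A)).
Implicit Types (m : seq nat) (s : sketch) (p : profile).

Definition missing w : {set state A} := ~: image_word A w.

Definition fibre l (q : state A) : {set state A} := [set x | trans x l == q].

Lemma deficiencyE w : deficiency A w = #|missing w|.
Proof. by rewrite /deficiency /missing [RHS]cardsCs setCK. Qed.

Lemma image_word_cat u v :
  image_word A (u ++ v) = [set act q v | q in image_word A u].
Proof.
rewrite /image_word -imset_comp.
by apply: eq_imset => q; rewrite /act /= foldl_cat.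
Qed.

Lemma leq_missing_infix u w : infix u w -> #|missing u| <= #|missing w|.
Proof.
case/infixP=> x [y ->]; rewrite -!deficiencyE leq_sub2l //.
rewrite catA image_word_cat (leq_trans (leq_imset_card _ _)) // image_word_cat.
by apply/subset_leq_card/subsetP=> _ /imsetP[q _ ->]; apply: imset_f.
Qed.

Lemma missing_nil : missing [::] = set0.
Proof.
apply/setP=> q; rewrite !inE; apply/negbTE; rewrite negbK.
by apply/imsetP; exists q.
Qed.

Lemma missing_rcons w l :
  missing (rcons w l) = [set q | fibre l q \subset missing w].
Proof.
apply/setP=> q; rewrite !inE -cats1 image_word_cat.
apply/negP/subsetP=> [nq x | sub /imsetP[x xw Dq]].
  rewrite !inE => /eqP Dq; apply/negP=> xw; case: nq.
  by apply/imsetP; exists x.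
by have := sub x; rewrite !inE xw Dq /= eqxx => /(_ isT).
Qed.

Lemma missing1 l : missing [:: l] = [set q | fibre l q == set0].
Proof.
apply/setP=> q; rewrite (missing_rcons [::]) missing_nil !inE.
by rewrite subset0.
Qed.

Lemma trans_not_missing l q : trans q l \notin missing [:: l].
Proof. by rewrite missing1 inE; apply/set0Pn; exists q; rewrite inE. Qed.

(** The sizes of the fibres add up to the number of states, so the excesses
    over 1 of the nonempty fibres balance the empty fibres.  The predecessor is
    truncated, so that empty fibres contribute 0. *)
Lemma sum_excess l : \sum_q #|fibre l q|.-1 = #|missing [:: l]|.
Proof.
have card_fibres : \sum_q #|fibre l q| = #|state A|.
  rewrite -[RHS]sum1_card [RHS](partition_big (fun x => trans x l) predT) //=.
  apply: eq_bigr => q _; rewrite -sum1_card.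
  by apply: eq_bigl => x; rewrite inE.
apply/eqP; rewrite -(eqn_add2r #|state A|) -[X in _ + X == _]sum1_card.
rewrite -card_fibres -[#|missing _|]sum1_card [X in _ == X + _]big_mkcond.
rewrite -!big_split /=; apply/eqP/eq_bigr=> q _.
rewrite missing1 inE -cards_eq0.
by case: #|fibre l q| => // k; rewrite addn1.
Qed.

(** * Names for states *)

(** The list [qs], without repetition, holds the states named so far, and the
    name of a state is its position in [qs]. *)
Definition states qs m : {set state A} := [set x in [seq nth q0 qs i | i <- m]].

Definition below (n : nat) m := all (gtn n) m.

Lemma states_cat qs zs m : below (size qs) m ->
  states (qs ++ zs) m = states qs m.
Proof.
move/allP=> bm; apply/setP=> x; rewrite !inE; congr (x \in _).
by apply/eq_in_map => i /bm /=; rewrite nth_cat => ->.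
Qed.

Lemma below_cat qs zs m : below (size qs) m -> below (size (qs ++ zs)) m.
Proof.
by apply: sub_all => i /= lt_i; rewrite size_cat (leq_trans lt_i) ?leq_addr.
Qed.

Lemma mem_states qs m i : uniq qs -> below (size qs) m -> i < size qs ->
  (nth q0 qs i \in states qs m) = (i \in m).
Proof.
move=> Uqs /allP bm lt_i; rewrite inE; apply/mapP/idP=> [[j jm] | im].
  by move/eqP; rewrite nth_uniq // ?bm // => [/eqP-> | ]; last exact: bm.
by exists i.
Qed.

Lemma states_cons qs i m : states qs (i :: m) = nth q0 qs i |: states qs m.
Proof. by apply/setP=> x; rewrite !inE. Qed.

(** The list [ys] holds the values whose fibres are the known ones. *)
Record depicts qs l p : Prop := Depicts {
  lost_below : below (size qs) (lost p);
  lost_size : size (lost p) = #|missing [:: l]|;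
  lost_states : states qs (lost p) = missing [:: l];
  fibres_below : all (below (size qs)) (fibres p);
  fibres_states : exists ys, [/\ uniq ys,
    [seq states qs c | c <- fibres p] = [seq fibre l y | y <- ys] &
    \sum_(y <- ys) #|fibre l y|.-1 + spare p = #|missing [:: l]|];
  arrows_states : forall e, e \in arrows p -> [/\ e.1 < size qs, e.2 < size qs &
    trans (nth q0 qs e.1) l = nth q0 qs e.2]
}.

Record models qs s : Prop := Models {
  names_uniq : uniq qs;
  names_size : known_names s = size qs;
  models_on : forall l, depicts qs l (profile_of s l)
}.

Lemma depicts_cat qs zs l p : depicts qs l p -> depicts (qs ++ zs) l p.
Proof.
case=> lb lsz lden fb fden aden; split=> //.
- exact: below_cat.
- by rewrite states_cat.
- by apply: sub_all fb => c; apply: below_cat.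
- case: fden => ys [Uys Dys Sys]; exists ys; split=> //; rewrite -Dys.
  by apply/eq_in_map => c /(allP fb)/states_cat->.
- move=> e /aden[lt1 lt2 De]; rewrite size_cat !nth_cat lt1 lt2 De.
  by split=> //; apply: ltn_addr.
Qed.

Lemma models_update qs zs s l n p :
  models qs s -> uniq (qs ++ zs) -> n = size (qs ++ zs) ->
  depicts (qs ++ zs) l p -> models (qs ++ zs) (update s l n p).
Proof.
move=> [_ _ Ms] Uq Dn Dp; split=> //; first by case: l Dp.
by case: l Dp => Dp [] //=; apply: depicts_cat; [apply: (Ms b) | apply: (Ms a)].
Qed.

(** The elements of [X] without a name are appended to [qs], which gives them
    the fresh names used by [namings]. *)
Lemma naming_exists qs cand (X : {set state A}) :
    uniq qs -> below (size qs) cand ->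
    (forall i, i < size qs -> nth q0 qs i \in X -> i \in cand) ->
  exists x zs, [/\ x \in namings (size qs) cand #|X|,
    uniq (qs ++ zs) /\ x.2 = size (qs ++ zs), below x.2 x.1,
    size x.1 = #|X| & states (qs ++ zs) x.1 = X].
Proof.
move=> Uqs; elim: cand X => [|i cand IH] X /= bc Xc.
  exists (iota (size qs) #|X|, size qs + #|X|), (enum X).
  rewrite inE eqxx cat_uniq Uqs enum_uniq size_cat -cardE size_iota andbT.
  have Dx : [seq nth q0 (qs ++ enum X) j | j <- iota (size qs) #|X|] = enum X.
    rewrite map_nth_iota ?size_cat ?addKn -?cardE // drop_size_cat //.
    by rewrite cardE take_size.
  split=> //=.
  - split=> //; apply/hasPn=> x; rewrite mem_enum => xX.
    apply/negP=> /(nthP q0)[i lt_i Dx'].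
    by have:= Xc i lt_i; rewrite Dx' xX => /(_ isT).
  - by apply/allP=> j; rewrite mem_iota => /andP[].
  - by apply/setP=> x; rewrite inE Dx mem_enum.
case/andP: bc => lt_i bc.
have [iX | iX] := boolP (nth q0 qs i \in X); last first.
  have [j lt_j jX | x [zs [xn Uz bx sx Dx]]] := IH X bc.
    have:= Xc j lt_j jX; rewrite inE => /predU1P[Dj|//].
    by rewrite -Dj jX in iX.
  by exists x, zs; split=> //; rewrite mem_cat xn orbT.
have [j lt_j | x [zs [xn Uz bx sx Dx]]] := IH (X :\ nth q0 qs i) bc.
  rewrite in_setD1 nth_uniq // => /andP[neq_ji /(Xc j lt_j)].
  by rewrite inE (negPf neq_ji).
exists (i :: x.1, x.2), zs; rewrite (cardsD1 (nth q0 qs i)) iX /=.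
split=> //; first by rewrite mem_cat map_f.
- by rewrite bx andbT; case: Uz => _ ->; rewrite size_cat ltn_addr.
- by rewrite sx.
- by rewrite states_cons Dx nth_cat lt_i setD1K.
Qed.

Lemma fibre_of_unknown p i : i \notin fibre_of p i ->
  forall c, c \in fibres p -> i \notin c.
Proof.
move=> ni c cp; apply: contra ni => ic; rewrite /fibre_of.
have: c \in [seq c' <- fibres p | i \in c'] by rewrite mem_filter ic.
case E: [seq _ <- _ | _] => [//|c' t] _ /=.
by have: c' \in c' :: t by [rewrite inE eqxx]; rewrite -E mem_filter => /andP[].
Qed.

Lemma fibre_of_mem p i : i \in fibre_of p i -> fibre_of p i \in fibres p.
Proof.
rewrite /fibre_of; case E: [seq _ <- _ | _] => [//|c t] /= _.
by have: c \in c :: t by [rewrite inE eqxx]; rewrite -E mem_filter => /andP[].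
Qed.

Lemma fibre_ofP qs l p i : uniq qs -> depicts qs l p -> i \in fibre_of p i ->
  [/\ i < size qs, below (size qs) (fibre_of p i) &
      states qs (fibre_of p i) = fibre l (trans (nth q0 qs i) l)].
Proof.
move=> Uqs Dp ic; have cp := fibre_of_mem ic.
have bc := allP (fibres_below Dp) _ cp; have lt_i := allP bc _ ic.
split=> //; have [ys [_ Dys _]] := fibres_states Dp.
have /mapP[y _ Dc] : states qs (fibre_of p i) \in [seq fibre l y | y <- ys].
  by rewrite -Dys map_f.
have : nth q0 qs i \in states qs (fibre_of p i) by rewrite mem_states.
by rewrite Dc inE => /eqP->.
Qed.

(** * Soundness of the case analysis *)

(** The automaton itself follows one of the branches that [cont] has to accept:
    new states may be named, and the enlarged description is still true. *)
Definition true_branch qs (cont : sketch -> bool) : Prop :=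
  exists zs s', models (qs ++ zs) s' /\ cont s'.

Lemma true_branch_here qs s (cont : sketch -> bool) :
  models qs s -> cont s -> true_branch qs cont.
Proof. by exists [::], s; rewrite cats0. Qed.

Lemma true_branch_cat qs zs cont :
  true_branch (qs ++ zs) cont -> true_branch qs cont.
Proof. by case=> zs' [s]; rewrite -catA; exists (zs ++ zs'), s. Qed.

Definition sound (ask : nat -> sketch -> (sketch -> bool) -> bool) : Prop :=
  forall i qs s cont, i < size qs -> models qs s -> ask i s cont ->
  true_branch qs cont.

(** The fibre of [i] is not among the known ones, so by [sum_excess] it has at
    most [spare] elements besides [i]. *)
Lemma reveal_fibreP l : sound (reveal_fibre l).
Proof.
move=> i qs s cont lt_i Ms; have [Uqs Ds Mon] := Ms; have Dp := Mon l.
rewrite /reveal_fibre; case: ifPn => [_ | ni /allP ok].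
  exact: true_branch_here Ms.
have [ys [Uys Dys Sys]] := fibres_states Dp.
set y := trans (nth q0 qs i) l; pose X := fibre l y :\ nth q0 qs i.
have iy : nth q0 qs i \in fibre l y by rewrite inE.
have ny : y \notin ys.
  apply/negP=> /(map_f (fibre l)); rewrite -Dys => /mapP[c cp Dc].
  have := fibre_of_unknown ni cp.
  by rewrite -(mem_states Uqs (allP (fibres_below Dp) _ cp) lt_i) -Dc iy.
have cX : #|fibre l y|.-1 = #|X| by rewrite (cardsD1 (nth q0 qs i)) iy.
have leX : #|X| <= spare (profile_of s l).
  rewrite -(leq_add2l (\sum_(z <- ys) #|fibre l z|.-1)) Sys -cX -sum_excess.
  have Uyys : uniq (y :: ys) by rewrite /= ny.
  have -> : \sum_(z <- ys) #|fibre l z|.-1 + #|fibre l y|.-1 =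
            \sum_(z <- y :: ys) #|fibre l z|.-1 by rewrite big_cons addnC.
  by rewrite (big_uniq _ Uyys) [leqRHS](bigID [in y :: ys]) leq_addr.
have [|j lt_j jX|x [zs [xn [Uz x2] bx sx Dx]]] :=
  @naming_exists qs [seq j <- iota 0 (known_names s) |
     (j != i) && ~~ has (fun c => j \in c) (fibres (profile_of s l))] X Uqs.
- by apply/allP=> j; rewrite mem_filter mem_iota Ds => /andP[].
- rewrite mem_filter mem_iota Ds lt_j !andbT /=.
  move: jX; rewrite in_setD1 nth_uniq // => /andP[-> jy] /=.
  apply/hasPn=> c cp; have bc := allP (fibres_below Dp) _ cp.
  rewrite -(mem_states Uqs bc lt_j).
  have /mapP[z zys ->] : states qs c \in [seq fibre l z | z <- ys].
    by rewrite -Dys map_f.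
  by move: jy; rewrite !inE => /eqP->; apply: contra ny => /eqP->.
have := ok #|X|; rewrite mem_iota ltnS leX => /(_ isT)/allP/(_ x).
rewrite Ds in xn * => /(_ xn) okx; exists zs; eexists; split; last exact: okx.
apply: models_update => //.
have [lb lsz lden fb _ aden] := depicts_cat zs Dp; split=> //=.
  by rewrite fb -x2 bx andbT x2 size_cat ltn_addr.
exists (y :: ys); rewrite /= ny Uys big_cons; split=> //.
- congr (_ :: _); first by rewrite states_cons Dx nth_cat lt_i setD1K.
  by rewrite -Dys; apply/eq_in_map => c /(allP (fibres_below Dp))/states_cat->.
- by rewrite cX addnC addnCA addnA subnKC // addnC.
Qed.

Lemma value_ofP qs l p i (v : nat) : uniq qs -> depicts qs l p ->
    i \in fibre_of p i -> value_of p i = Some v ->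
  v < size qs /\ nth q0 qs v = trans (nth q0 qs i) l.
Proof.
move=> Uqs Dp ic; rewrite /value_of.
case E: [seq _ | _ <- _ & _] => [//|v' t] /= [<-].
have: v' \in v' :: t by rewrite inE eqxx.
rewrite -E => /mapP[e]; rewrite mem_filter => /andP[ec ep] ->.
have [lt1 lt2 De] := arrows_states Dp ep.
have [_ bc Dc] := fibre_ofP Uqs Dp ic; split=> //; rewrite -De.
by move: ec; rewrite -(mem_states Uqs bc lt1) Dc inE => /eqP.
Qed.

(** The image of [i] is not missed by the letter, and an arrow that ends there
    would start in the known fibre of [i], so that the value would be known. *)
Lemma reveal_valueP l : sound (reveal_value l).
Proof.
move=> i qs s cont lt_i Ms; have [Uqs Ds Mon] := Ms; have Dp := Mon l.
rewrite /reveal_value; set p := profile_of s l in Dp *.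
case E: (value_of p i) => [v|] /=.
  exact: true_branch_here Ms.
case/andP=> ic /allP ok; have [_ bc Dc] := fibre_ofP Uqs Dp ic.
set y := trans (nth q0 qs i) l in Dc.
have [|j lt_j|x [zs [xn [Uz x2] bx sx Dx]]] :=
  @naming_exists qs [seq j <- iota 0 (known_names s) |
     j \notin lost p ++ [seq e.2 | e <- arrows p]] [set y] Uqs.
- by apply/allP=> j; rewrite mem_filter mem_iota Ds => /andP[].
- rewrite inE mem_filter mem_iota Ds lt_j !andbT => /eqP Dj.
  rewrite mem_cat negb_or -(mem_states Uqs (lost_below Dp) lt_j).
  rewrite (lost_states Dp).
  rewrite Dj trans_not_missing; apply/mapP=> -[e ep De].
  have [lt1 lt2 te] := arrows_states Dp ep.
  have: e.1 \in fibre_of p i.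
    by rewrite -(mem_states Uqs bc lt1) Dc inE te -De Dj.
  move=> e1c; move: E; rewrite /value_of.
  have: e \in [seq e <- arrows p | e.1 \in fibre_of p i].
    by rewrite mem_filter e1c.
  by case: [seq _ <- _ | _].
rewrite cards1 in xn sx; rewrite Ds in xn ok.
exists zs; eexists; split; last exact: (ok _ xn).
apply: models_update => //.
have [lb lsz lden fb fden aden] := depicts_cat zs Dp; split=> //= e.
rewrite inE => /predU1P[-> /= | /aden//].
case: x {xn} sx bx Dx x2 => [[|j []]] //= n2 _ /andP[lt_j _] Dx Dn2.
rewrite Dn2 in lt_j; split=> //; first by rewrite size_cat ltn_addr.
have: nth q0 (qs ++ zs) j \in [set y] by rewrite -Dx mem_states ?inE //= lt_j.
by rewrite inE => /eqP->; rewrite nth_cat lt_i.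
Qed.

Lemma revealP ask m qs s cont :
  sound ask -> models qs s -> reveal ask m s cont -> true_branch qs cont.
Proof.
move=> askP; elim: m qs s => [|i m IH] qs s Ms /=.
  exact: true_branch_here Ms.
case/andP; rewrite (names_size Ms) => lt_i /(askP _ _ _ _ lt_i Ms).
by case=> zs [s1 [Ms1 /(IH _ _ Ms1)/true_branch_cat]].
Qed.

Lemma coveredP qs l p u m i : uniq qs -> depicts qs l p ->
    below (size qs) m -> states qs m = missing u -> i \in fibre_of p i ->
  covered p m i = (trans (nth q0 qs i) l \in missing (rcons u l)).
Proof.
move=> Uqs Dp bm Dm ic; have [_ bc Dc] := fibre_ofP Uqs Dp ic.
rewrite /covered ic missing_rcons inE -Dc -Dm /=.
apply/allP/subsetP=> [sub x | sub j jc].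
  rewrite !inE => /mapP[j jc ->]; apply: map_f; exact: sub.
have lt_j := allP bc _ jc.
by have := sub (nth q0 qs j); rewrite !mem_states // => ->.
Qed.

(** The states missed by the letter are missed by the longer word, and the
    images of covered names from distinct fibres are further, distinct ones. *)
Lemma too_manyP qs l p u m : uniq qs -> depicts qs l p ->
    below (size qs) m -> states qs m = missing u -> too_many p m ->
  2 < #|missing (rcons u l)|.
Proof.
move=> Uqs Dp bm Dm; rewrite /too_many; move/leq_trans; apply.
set m' := [seq i <- m | _].
pose vals r := [seq trans (nth q0 qs i) l | i <- r].
have m'P i : i \in m' -> i \in fibre_of p i /\ covered p m i.
  by rewrite mem_filter => /andP[cm _]; split=> //; case/andP: cm.
have [sub Uvals] : {subset independent p m' <= m'} /\
    uniq (vals (independent p m')).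
  elim: (m') m'P => //= i r IH rP.
  case: IH => [j jr|sub Uv]; first by apply: rP; rewrite inE jr orbT.
  case: ifPn => [_ | nh]; split=> //=.
  - by move=> j /sub jr; rewrite inE jr orbT.
  - by move=> j; rewrite !inE => /predU1P[->|/sub->]; rewrite ?eqxx ?orbT.
  rewrite Uv andbT; apply: contra nh => /mapP[j jr Dj].
  apply/hasP; exists j => //.
  have [ic _] := rP i (mem_head _ _); have [_ bc Dc] := fibre_ofP Uqs Dp ic.
  have [|jc _] := rP j; first by rewrite inE sub ?orbT.
  have [lt_j _ _] := fibre_ofP Uqs Dp jc.
  by rewrite -(mem_states Uqs bc lt_j) Dc inE Dj.
rewrite -(cardsID (missing [:: l])) (setIidPr _); last first.
  apply/subsetP=> q; rewrite missing1 missing_rcons !inE => /eqP->.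
  exact: sub0set.
rewrite (lost_size Dp) leq_add2l -(size_map (fun i => trans (nth q0 qs i) l)).
rewrite -(card_uniqP Uvals); apply/subset_leq_card/subsetP=> x.
case/mapP=> i /sub/m'P[ic cm] ->.
by rewrite inE trans_not_missing -(coveredP Uqs Dp bm Dm ic).
Qed.

(** A state missed by the longer word has an empty fibre, or is the image of
    some name in [m], which is then covered. *)
Lemma next_lostP qs s l u m m' : models qs s ->
    below (size qs) m -> states qs m = missing u -> next_lost s l m = Some m' ->
  below (size qs) m' /\ states qs m' = missing (rcons u l).
Proof.
case=> Uqs Ds Mon bm Dm; have Dp := Mon l; rewrite /next_lost.
case: ifP => // /andP[/allP known /allP valued] [<-] {m'}.
set m' := [seq j <- _ | _].
have bm' : below (size qs) m'.
  by apply/allP=> j; rewrite mem_filter mem_iota Ds => /andP[].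
split=> //; apply/setP=> q; apply/idP/idP.
  rewrite inE => /mapP[j jm' ->]; have lt_j := allP bm' _ jm'.
  move: jm'; rewrite mem_filter => /andP[/orP[jl|jv] _].
    have: nth q0 qs j \in missing [:: l].
      by rewrite -(lost_states Dp) (mem_states Uqs (lost_below Dp)).
    rewrite missing1 missing_rcons !inE => /eqP->; exact: sub0set.
  case/mapP: jv => i; rewrite mem_filter => /andP[cm /known /= ic] Dj.
  have [_ ->] := value_ofP Uqs Dp ic (esym Dj).
  by rewrite -(coveredP Uqs Dp bm Dm ic).
have [qM _ | ] := boolP (q \in missing [:: l]).
  have: q \in states qs (lost (profile_of s l)) by rewrite (lost_states Dp).
  rewrite inE => /mapP[j jl ->]; have lt_j := allP (lost_below Dp) _ jl.
  by rewrite mem_states // mem_filter jl mem_iota Ds.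
rewrite missing1 inE => /set0Pn[x xq] qM.
have: x \in states qs m.
  by rewrite Dm; move: qM; rewrite missing_rcons inE => /subsetP; apply.
rewrite inE => /mapP[i im Dx]; have /= ic := known i im.
move: xq qM; rewrite inE Dx => /eqP<-.
rewrite -(coveredP Uqs Dp bm Dm ic) => cm.
have vi : value_of (profile_of s l) i \in
    [seq value_of (profile_of s l) i | i <- m & covered (profile_of s l) m i].
  by apply: map_f; rewrite mem_filter cm.
have := valued _ vi; case E: (value_of _ i) => [v|] // _.
have [lt_v <-] := value_ofP Uqs Dp ic E.
by rewrite mem_states // mem_filter -E vi orbT mem_iota Ds.
Qed.

Lemma read_wordP w u m qs s cont : models qs s ->
    below (size qs) m -> states qs m = missing u -> #|missing (u ++ w)| <= 2 ->
    read_word w m s cont ->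
  true_branch qs cont.
Proof.
elim: w u m qs s => [|l w IH] u m qs s Ms bm Dm small /=.
  exact: true_branch_here Ms.
case/(revealP (@reveal_fibreP l) Ms) => zs1 [s1 [Ms1]].
rewrite -(states_cat zs1 bm) in Dm; have {}bm := below_cat zs1 bm.
case: ifP => [many | _].
  have := too_manyP (names_uniq Ms1) (models_on Ms1 l) bm Dm many.
  rewrite ltnNge (leq_trans _ small) // -cat_rcons.
  by apply: leq_missing_infix; rewrite prefix_infix ?prefix_prefix.
case: ifP => _; first by exists zs1, s1.
case/(revealP (@reveal_valueP l) Ms1) => zs2 [s2 [Ms2]].
case E: next_lost => [m'|] // ok.
rewrite -(states_cat zs2 bm) in Dm; have {}bm := below_cat zs2 bm.
have [bm' Dm'] := next_lostP Ms2 bm Dm E.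
do 2!apply: true_branch_cat; apply: (IH _ _ _ _ Ms2 bm' Dm' _ ok).
by rewrite cat_rcons.
Qed.

Lemma read_allP ws qs s cont : models qs s ->
    {in ws, forall w, #|missing w| <= 2} -> read_all ws s cont ->
  true_branch qs cont.
Proof.
elim: ws qs s => [|w ws IH] qs s Ms small /=.
  exact: true_branch_here Ms.
have Dnil : states qs [::] = missing [::].
  by rewrite missing_nil; apply/setP=> q; rewrite !inE.
case/(read_wordP (u := [::]) (m := [::]) Ms isT Dnil).
  by rewrite small ?mem_head.
move=> zs [s1 [Ms1 ok]]; apply: true_branch_cat.
apply: (IH _ _ Ms1 _ ok) => u uw.
by rewrite small // inE uw orbT.
Qed.

Lemma stableP qs s F w : models qs s -> stable s F -> #|missing w| <= 2.
Proof.
move=> Ms /andP[nilF /allP closedF].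
suff [m [mF _ <-]] : exists m,
    [/\ m \in F, below (size qs) m & states qs m = missing w].
  have /andP[sm _] := closedF m mF; apply: leq_trans sm.
  by rewrite -(size_map (nth q0 qs)) cardsE card_size.
elim/last_ind: w => [|w l [m [mF bm Dm]]].
  exists [::]; split=> //; rewrite missing_nil.
  by apply/setP=> q; rewrite !inE.
have /andP[_ /allP/(_ l)] := closedF m mF.
have -> : l \in [:: a; b] by case: l.
move/(_ isT); case E: next_lost => [m'|] // m'F.
by exists m'; have [] := next_lostP Ms bm Dm E.
Qed.

Lemma exploreP fuel F todo qs s : models qs s -> explore fuel F todo s ->
  forall w, #|missing w| <= 2.
Proof.
elim: fuel F todo qs s => [|fuel IH] F [|m todo] qs s Ms /=;
  try by move=> /stableP st w; apply: st Ms.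
case/(revealP (@reveal_fibreP a) Ms) => zs1 [s1 [Ms1]].
case/(revealP (@reveal_valueP a) Ms1) => zs2 [s2 [Ms2]].
case/(revealP (@reveal_fibreP b) Ms2) => zs3 [s3 [Ms3]].
by case/(revealP (@reveal_valueP b) Ms3) => zs4 [s4 [Ms4 /(IH _ _ _ _ Ms4)]].
Qed.

Lemma startP cont : (forall l, #|missing [:: l]| <= 2) -> start cont ->
  exists qs s, models qs s /\ cont s.
Proof.
move=> small /allP ok.
have depicts_lost qs l m : below (size qs) m -> size m = #|missing [:: l]| ->
    states qs m = missing [:: l] ->
    depicts qs l (Profile m [::] #|missing [:: l]| [::]).
  by move=> bm sm Dm; split=> //; exists [::]; rewrite big_nil.
have [//|x [qs1 [xn [Uqs x2] bx sx Dx]]] :=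
  @naming_exists [::] [::] (missing [:: a]) isT isT.
have [||y [qs2 [yn [Uqs2 y2] sub_y sy Dy]]] :=
  @naming_exists qs1 (iota 0 x.2) (missing [:: b]) Uqs.
- by apply/allP=> j; rewrite mem_iota x2.
- by move=> j lt_j _; rewrite mem_iota x2.
have := ok #|missing [:: a]|; rewrite mem_iota ltnS small.
move=> /(_ isT)/allP/(_ x xn)/allP/(_ #|missing [:: b]|).
rewrite mem_iota ltnS small => /(_ isT)/allP/(_ y).
rewrite x2 in bx yn * => /(_ yn) ok_s.
exists (qs1 ++ qs2); eexists; split; last exact: ok_s.
split=> // -[]; last by apply: depicts_lost; rewrite // -y2.
by apply/depicts_cat/depicts_lost.
Qed.

(** The start of the analysis needs the letters to have deficiency at most 2;
    they are factors of the probes [aaa] and [bbb]. *)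
Lemma probes_suffice : {in probes, forall w, #|missing w| <= 2} ->
  forall w, #|missing w| <= 2.
Proof.
move=> small.
have small1 l : #|missing [:: l]| <= 2.
  have /small : [:: l; l; l] \in probes by case: l.
  apply: leq_trans; apply: leq_missing_infix.
  by rewrite prefix_infix //= eqxx.
have [qs [s [Ms /(read_allP Ms small)]]] := startP small1 search_succeeds.
by case=> zs [s' [/exploreP]]; apply.
Qed.

End Semantics.

(** * The theorem *)

Theorem mainTheorem1 (w : seq letter) :
  full 3 w ->
  (forall u : seq letter, u \in W -> infix u w) ->
  collapsing 3 w.
Proof.
move=> full_w Ww.
have probes_w u : u \in probes -> infix u w.
  by do 2!(rewrite in_cons => /predU1P[->|]; first exact: full_w); apply: Ww.
have size_w : 2 < size w by exact: size_infix (full_w [:: a; a; a] erefl).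
split=> [|A [v [_ def_v]]]; first exact: leq_trans size_w.
split; first exact: leq_trans size_w.
have [q0 _] : exists q0, q0 \in missing A v.
  by apply/card_gt0P; rewrite -deficiencyE (leq_trans _ def_v).
rewrite leqNgt ltnS; apply/negP=> def_w; move: def_v; rewrite leqNgt ltnS.
rewrite deficiencyE (probes_suffice q0) // => u /probes_w uw.
by rewrite (leq_trans (leq_missing_infix _ uw)) // -deficiencyE.
Qed.
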